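(* Suppose there exists a strongly regular graph with parameters $(n_0,t,\lambda,\mu)$, and let $$k_0=\max\{n_0-t,\ t,\ n_0-2t+2\lambda+3,\ n_0-2t+2\mu-1,\ 2t-2\lambda-1,\ 2t-2\mu+2\}.$$ If $k_0\le n_0$, then for every $i=0,1,\dots,n_0+1$ there exists a graph in $\mathfrak{Gr}(n_0+i,k_0+i)$.
   Context: All graphs are finite, simple and undirected. A graph is strongly regular with parameters $(n,t,\lambda,\mu)$ if it has $n$ vertices, every vertex has degree $t$, any two adjacent vertices have exactly $\lambda$ common neighbours, and any two distinct nonadjacent vertices have exactly $\mu$ common neighbours. For a graph $G=(V,E)$ and $x\in V$, $N[x]=\{x\}\cup\{y: xy\in E\}$. A set $C\subseteq V$ is identifying if $N[x]\cap C\ne\emptyset$ for every $x\in V$ and $N[x]\cap C\neq N[y]\cap C$ for all distinct $x,y\in V$. For $n\ge k\ge1$, $\mathfrak{Gr}(n,k)$ is the set of graphs on $n$ vertices in which every $k$-element subset of vertices is identifying. *)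

(* Defs.v *)
From mathcomp Require Import all_boot.

Set Implicit Arguments.
Unset Strict Implicit.
Unset Printing Implicit Defensive.

Record graph := Graph {
  vertex :> finType;
  adj : rel vertex;
  adj_sym : symmetric adj;
  adj_irr : irreflexive adj
}.

Definition open_nbh (G : graph) (x : G) : {set G} := [set y | adj x y].

Definition closed_nbh (G : graph) (x : G) : {set G} := x |: open_nbh x.

Definition strongly_regular (G : graph) (n t lam mu : nat) : Prop :=
  [/\ #|G| = n,
      forall x : G, #|open_nbh x| = t,
      forall x y : G, adj x y -> #|open_nbh x :&: open_nbh y| = lam
    & forall x y : G, x != y -> ~~ adj x y ->
        #|open_nbh x :&: open_nbh y| = mu].

Definition identifying (G : graph) (C : {set G}) : Prop :=
  (forall x : G, closed_nbh x :&: C != set0) /\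
  (forall x y : G, x != y -> closed_nbh x :&: C != closed_nbh y :&: C).

(* The class is only meaningful for 1 <= k <= n; the range is part of the
   predicate, so that membership is never vacuous for lack of k-subsets. *)
Definition Gr (n k : nat) (G : graph) : Prop :=
  [/\ 1 <= k <= n,
      #|G| = n
    & forall C : {set G}, #|C| = k -> identifying C].

(* Main.v *)
(** A set meets every k-subset of an n-set iff it has more than n - k elements,
    so all k-subsets are identifying iff every closed neighbourhood, and every
    symmetric difference of two of them, has more than n - k elements.  Since
    n - k does not depend on i, it suffices to enlarge a strongly regular graph
    on V without destroying these bounds.  Take two copies of V, each carrying
    the given graph, join x in one copy to y in the other when x and y are not
    adjacent (x = y included), and add an apex joined to everything.  The first
    copy together with any i vertices of the second works for i <= n0; the whole
    graph works for i = n0 + 1. *)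

Require Import Defs.
From mathcomp Require Import all_boot all_order all_algebra.
From mathcomp Require Import zify.

Set Implicit Arguments.
Unset Strict Implicit.
Unset Printing Implicit Defensive.

(** * Symmetric differences and a counting criterion for identifying sets *)

Definition symdiff (T : finType) (A B : {set T}) : {set T} :=
  (A :\: B) :|: (B :\: A).

Lemma in_symdiff (T : finType) (A B : {set T}) x :
  (x \in symdiff A B) = (x \in A) (+) (x \in B).
Proof. by rewrite !inE; case: (x \in A); case: (x \in B). Qed.

Lemma symdiffC (T : finType) (A B : {set T}) : symdiff A B = symdiff B A.
Proof. exact: setUC. Qed.

Lemma card_symdiff (T : finType) (A B : {set T}) :
  #|symdiff A B| + 2 * #|A :&: B| = #|A| + #|B|.
Proof.
have := cardsID A B; have := cardsID B A; rewrite [B :&: A]setIC.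
rewrite /symdiff cardsU.
suff -> : (A :\: B) :&: (B :\: A) = set0 by rewrite cards0; lia.
by apply/setP => x; rewrite !inE; case: (x \in A); case: (x \in B).
Qed.

(** By inclusion-exclusion, any set with more than [#|G| - #|C|] elements meets [C]. A point of [C]
    in a symmetric difference lies in just one of the two closed neighbourhoods, so it separates
    them. *)
Lemma identifying_of_card (G : graph) (C : {set G}) :
  (forall x : G, #|G| < #|C| + #|closed_nbh x|) ->
  (forall x y : G, x != y ->
     #|G| < #|C| + #|symdiff (closed_nbh x) (closed_nbh y)|) ->
  identifying C.
Proof.
have meet (A : {set G}) : #|G| < #|C| + #|A| -> exists2 z, z \in A & z \in C.
  move=> ltA; have [AC0 | [z]] := set_0Vmem (A :&: C); last first.
    by case/setIP => zA zC; exists z.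
  exfalso; move: ltA (cardsUI A C) (subset_leq_card (subsetT (A :|: C))).
  by rewrite AC0 cards0 cardsT; lia.
move=> big_nbh big_diff; split=> [x | x y neq_xy].
  have [z zx zC] := meet _ (big_nbh x).
  by apply/set0Pn; exists z; rewrite inE zx.
have [z] := meet _ (big_diff x y neq_xy).
rewrite in_symdiff => zxy zC; apply: contraTneq zxy => /setP/(_ z).
by rewrite !in_setI zC !andbT => ->; rewrite addbb.
Qed.

(** * Induced subgraphs, with all counting done in the ambient graph *)

Section Induced.

Variables (G : graph) (U : {set G}).

Definition induced_adj : rel {x : G | x \in U} :=
  fun x y => adj (val x) (val y).

Lemma induced_adj_sym : symmetric induced_adj.
Proof. by move=> x y; apply: adj_sym. Qed.

Lemma induced_adj_irr : irreflexive induced_adj.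
Proof. by move=> x; apply: adj_irr. Qed.

Definition induced := Graph induced_adj_sym induced_adj_irr.

Lemma mem_closed_nbh_induced (x y : induced) :
  (y \in closed_nbh x) = (val y \in closed_nbh (val x)).
Proof. by rewrite !inE -val_eqE. Qed.

Lemma card_induced_preim (A : {set G}) (B : {set induced}) :
  (forall y : induced, (y \in B) = (val y \in A)) -> #|B| = #|A :&: U|.
Proof.
move=> BA; rewrite -(card_imset _ val_inj); apply: eq_card => z.
apply/imsetP/setIP => [[y yB ->] | [zA zU]]; first by rewrite -BA (valP y).
by exists (Sub z zU : induced); rewrite ?BA.
Qed.

Lemma induced_Gr n k : 0 < k <= n -> #|U| = n ->
  (forall x, x \in U -> n < k + #|closed_nbh x :&: U|) ->
  (forall x y, x \in U -> y \in U -> x != y ->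
     n < k + #|symdiff (closed_nbh x) (closed_nbh y) :&: U|) ->
  Gr n k induced.
Proof.
move=> kn cardU big_nbh big_diff.
have card_ind : #|induced| = n by rewrite -cardU card_sig; apply: eq_card.
split=> // C cardC; apply: identifying_of_card => [x | x y neq_xy].
  rewrite card_ind cardC (card_induced_preim (A := closed_nbh (val x))).
    by apply: big_nbh; apply: valP.
  by move=> y; rewrite mem_closed_nbh_induced.
rewrite card_ind cardC.
rewrite (card_induced_preim
           (A := symdiff (closed_nbh (val x)) (closed_nbh (val y)))).
  by apply: big_diff; rewrite ?val_eqE //; apply: valP.
by move=> z; rewrite !in_symdiff !mem_closed_nbh_induced.
Qed.

End Induced.

(** * The doubled graph with an apex *)

Section Double.

Variable G : graph.

Definition double_adj (u v : option (G + G)) : bool :=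
  match u, v with
  | None, None => false
  | None, Some _ | Some _, None => true
  | Some (inl x), Some (inl y) | Some (inr x), Some (inr y) => adj x y
  | Some (inl x), Some (inr y) | Some (inr x), Some (inl y) => ~~ adj x y
  end.

Lemma double_adj_sym : symmetric double_adj.
Proof. by case=> [[]x|] [[]y|] //=; rewrite adj_sym. Qed.

Lemma double_adj_irr : irreflexive double_adj.
Proof. by case=> [[]x|] //=; rewrite adj_irr. Qed.

Definition double := Graph double_adj_sym double_adj_irr.

Let fst_copy (x : G) : double := Some (inl x).
Let snd_copy (x : G) : double := Some (inr x).

(** A vertex is joined to its own twin, so its closed neighbourhood meets the opposite copy in the
    complement of an open neighbourhood. *)
Let double_nbhE :
  ((forall x y, (fst_copy y \in closed_nbh (fst_copy x)) = (y \in closed_nbh x)) *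
   (forall x y, (snd_copy y \in closed_nbh (snd_copy x)) = (y \in closed_nbh x)) *
   (forall x y, (snd_copy y \in closed_nbh (fst_copy x)) = (y \notin open_nbh x)) *
   (forall x y, (fst_copy y \in closed_nbh (snd_copy x)) = (y \notin open_nbh x)) *
   (forall u : double, u \in closed_nbh (None : double)))%type.
Proof.
split=> [|[[]z|]]; last by rewrite !inE.
- by split=> [|x y]; [split=> [|x y]; [split=> x y|]|]; rewrite !inE.
- by rewrite !inE.
- by rewrite !inE.
Qed.

(** The apex is left uncounted: only lower bounds are wanted. *)
Lemma leq_card_double (A B : {set G}) (X : {set double}) :
  (forall x, x \in A -> fst_copy x \in X) ->
  (forall x, x \in B -> snd_copy x \in X) ->
  #|A| + #|B| <= #|X|.
Proof.
move=> AX BX.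
have fst_inj : injective fst_copy by move=> x y [].
have snd_inj : injective snd_copy by move=> x y [].
rewrite -(card_imset _ fst_inj) -(card_imset _ snd_inj) -cardsUI.
suff -> : fst_copy @: A :&: snd_copy @: B = set0.
  rewrite cards0 addn0 subset_leq_card // subUset.
  by apply/andP; split; apply/subsetP => _ /imsetP[x xX ->]; auto.
apply/setP => u; rewrite !inE; apply/negP => /andP[/imsetP[x _ ->]].
by case/imsetP.
Qed.

(** * Intersection numbers in the strongly regular graph *)

Variables n t lam mu k : nat.
Hypothesis srgG : strongly_regular G n t lam mu.
(** One inequality per term of the maximum, rearranged into sums to avoid truncated subtraction. *)
Hypotheses (k1 : n <= k + t) (k2 : t <= k).
Hypotheses (k3 : n + 2 * lam + 3 <= k + 2 * t) (k4 : n + 2 * mu <= k + 2 * t + 1).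
Hypotheses (k5 : 2 * t <= k + 2 * lam + 1) (k6 : 2 * t + 2 <= k + 2 * mu).
Hypothesis le_kn : k <= n.

Let card_open (x : G) : #|open_nbh x| = t.
Proof. by case: srgG. Qed.

Let card_closed (x : G) : #|closed_nbh x| = t.+1.
Proof. by rewrite cardsU1 inE adj_irr card_open. Qed.

Let cardC (A : {set G}) : #|~: A| + #|A| = n.
Proof. by case: srgG => <- _ _ _; rewrite addnC cardsC. Qed.

Let nbh_inter (x y : G) : x != y ->
  #|open_nbh x :&: open_nbh y| = if adj x y then lam else mu.
Proof. by case: srgG => _ _ lamE muE neq; case: ifPn => xy; auto. Qed.

(** The vertex [x] is added to the common neighbours exactly when it is adjacent to [y]. This mixed
    count serves pairs from different copies. *)
Let card_inter_closed_open (x y : G) : x != y ->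
  #|closed_nbh x :&: open_nbh y| = if adj x y then lam.+1 else mu.
Proof.
move=> neq; rewrite /closed_nbh setIUl cardsU (nbh_inter neq).
have -> : [set x] :&: open_nbh y :&: (open_nbh x :&: open_nbh y) = set0.
  apply/setP => z; rewrite !inE; case: eqP => //= ->.
  by rewrite adj_irr andbF.
rewrite cards0 subn0; case: ifPn => xy.
  rewrite (setIidPl _) ?cards1 ?add1n // sub1set inE.
  by rewrite adj_sym.
suff -> : [set x] :&: open_nbh y = set0 by rewrite cards0.
by apply/setP => z; rewrite !inE; case: eqP => //= ->; rewrite adj_sym (negPf xy).
Qed.

Let card_inter_closed (x y : G) : x != y ->
  #|closed_nbh x :&: closed_nbh y| = if adj x y then lam.+2 else mu.
Proof.
move=> neq; rewrite {2}/closed_nbh setIUr cardsU (card_inter_closed_open neq).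
have -> : closed_nbh x :&: [set y] :&: (closed_nbh x :&: open_nbh y) = set0.
  by apply/setP => z; rewrite !inE; case: (z =P y) => [->|]; rewrite ?adj_irr !andbF.
rewrite cards0 subn0; case: ifPn => xy.
  by rewrite (setIidPr _) ?cards1 ?add1n // sub1set !inE xy orbT.
suff -> : closed_nbh x :&: [set y] = set0 by rewrite cards0.
apply/setP => z; rewrite !inE; case: (z =P y) => [->|]; rewrite ?andbF //.
by rewrite eq_sym (negPf neq) (negPf xy).
Qed.

(** * Bounds inside a vertex set containing the first copy *)

Variable U : {set double}.
Hypothesis fst_copyU : forall x, fst_copy x \in U.
(** The apex differs from another vertex only at the non-neighbours of that vertex; it takes both
    full copies to make these [n - 1] in number. *)
Hypothesis apexU : None \in U -> U = setT.

Let leq_card_doubleU (A B : {set G}) (X : {set double}) :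
  (forall x, x \in A -> fst_copy x \in X) ->
  (forall x, x \in B -> snd_copy x \in X :&: U) ->
  #|A| + #|B| <= #|X :&: U|.
Proof.
by move=> AX BX; apply: leq_card_double => // x xA; rewrite inE AX ?fst_copyU.
Qed.

Lemma double_nbh_bound u : u \in U -> n < k + #|closed_nbh u :&: U|.
Proof.
case: u => [[]x|] xU; set X := closed_nbh _.
- suff: #|closed_nbh x| + #|@set0 G| <= #|X :&: U|.
    by rewrite card_closed cards0; move: k1; lia.
  by apply: leq_card_doubleU => y; rewrite ?inE // double_nbhE.
(* The first copy gives [n - t]; the vertex itself supplies the extra point needed when [t = k]. *)
- suff: #|~: open_nbh x| + #|[set x]| <= #|X :&: U|.
    by rewrite cards1; move: (cardC (open_nbh x)) k2; rewrite card_open; lia.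
  apply: leq_card_doubleU => y; first by rewrite double_nbhE inE.
  by rewrite inE => /eqP->; rewrite inE xU double_nbhE !inE eqxx.
- suff: #|~: @set0 G| + #|@set0 G| <= #|X :&: U|.
    by move: (cardC set0) k2 k3; rewrite cards0; lia.
  by apply: leq_card_doubleU => y; rewrite ?inE // double_nbhE.
Qed.

Let fst_fst (x y : G) : x != y ->
  n < k + #|symdiff (closed_nbh (fst_copy x)) (closed_nbh (fst_copy y)) :&: U|.
Proof.
move=> neq; set X := symdiff _ _.
have: #|symdiff (closed_nbh x) (closed_nbh y)| + #|@set0 G| <= #|X :&: U|.
  apply: leq_card_doubleU => z; last by rewrite inE.
  by rewrite !in_symdiff !double_nbhE.
move: (card_symdiff (closed_nbh x) (closed_nbh y)).
rewrite cards0 (card_inter_closed neq) !card_closed.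
(* The difference has size [2t - 2lam - 2] or [2t - 2mu + 2], matching [k3] and [k4] exactly. *)
by move: k3 k4; case: adj; lia.
Qed.

Let snd_snd (x y : G) : x != y -> snd_copy x \in U -> snd_copy y \in U ->
  n < k + #|symdiff (closed_nbh (snd_copy x)) (closed_nbh (snd_copy y)) :&: U|.
Proof.
move=> neq xU yU; set X := symdiff _ _.
(* On the first copy the two complements cancel. In the second, [x] and [y] are known to lie in [U],
   and they separate exactly when nonadjacent. *)
pose B := if adj x y then set0 else [set x; y].
have: #|symdiff (open_nbh x) (open_nbh y)| + #|B| <= #|X :&: U|.
  apply: leq_card_doubleU => z.
    by rewrite !in_symdiff !double_nbhE addbN addNb negbK.
  rewrite /B in_setI in_symdiff !double_nbhE; case: ifPn; rewrite !inE // => xy.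
  by case/orP => /eqP->; rewrite ?xU ?yU eqxx adj_irr ?(adj_sym y) (negPf xy)
                                 1?[y == x]eq_sym (negPf neq).
move: (card_symdiff (open_nbh x) (open_nbh y)).
rewrite (nbh_inter neq) !card_open /B; move: k3 k4.
by case: adj; rewrite ?cards2 ?neq ?cards0; lia.
Qed.

Let fst_snd (x y : G) : snd_copy y \in U ->
  n < k + #|symdiff (closed_nbh (fst_copy x)) (closed_nbh (snd_copy y)) :&: U|.
Proof.
move=> yU; set X := symdiff _ _.
(* Only one trace is complemented, so the difference is complemented too. The second copy of [y]
   misses the neighbourhood of [fst_copy x] exactly when [x] and [y] are adjacent. *)
pose B := if adj x y then [set y] else set0.
have: #|~: symdiff (closed_nbh x) (open_nbh y)| + #|B| <= #|X :&: U|.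
  apply: leq_card_doubleU => z.
    by rewrite in_setC !in_symdiff !double_nbhE addbN.
  rewrite /B in_setI in_symdiff !double_nbhE; case: ifPn; rewrite !inE // => xy.
  by move/eqP->; rewrite yU xy eqxx.
move: (cardC (symdiff (closed_nbh x) (open_nbh y))).
move: (card_symdiff (closed_nbh x) (open_nbh y)).
rewrite card_closed card_open /B; have [<-|neq] := eqVneq x y.
  (* For twins the two sets differ only at [x], leaving [n - 1] points; the hypotheses force
     [k >= 2], which suffices. *)
  rewrite (setIidPr _) ?card_open ?adj_irr ?cards0; last exact: subsetUr.
  by move: k1 k2 k3 le_kn; lia.
rewrite (card_inter_closed_open neq); move: k5 k6.
by case: adj; rewrite ?cards1 ?cards0; lia.
Qed.

Let apex_diff (u : option (G + G)) : u != None -> None \in U ->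
  n < k + #|symdiff (closed_nbh (None : double)) (closed_nbh (u : double)) :&: U|.
Proof.
move=> uN /apexU UT; set X := symdiff _ _.
have XE (z : double) : (z \in X) = (z \notin closed_nbh (u : double)).
  by rewrite in_symdiff double_nbhE.
(* The non-neighbours of [u] number [n - t - 1] in its own copy and [t] in the other; again
   [k >= 2]. *)
suff: n.-1 <= #|X :&: U| by move: k1 k2 k3 le_kn; lia.
case: u uN @X XE => [[]x|] // _ X XE; move: (cardC (closed_nbh x));
  rewrite card_closed => nE.
  suff: #|~: closed_nbh x| + #|open_nbh x| <= #|X :&: U|.
    by rewrite card_open; lia.
  by apply: leq_card_doubleU => z; rewrite ?UT ?setIT XE double_nbhE ?negbK // inE.
suff: #|open_nbh x| + #|~: closed_nbh x| <= #|X :&: U|.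
  by rewrite card_open; lia.
by apply: leq_card_doubleU => z; rewrite ?UT ?setIT XE double_nbhE ?negbK // inE.
Qed.

Lemma double_diff_bound u v : u \in U -> v \in U -> u != v ->
  n < k + #|symdiff (closed_nbh u) (closed_nbh v) :&: U|.
Proof.
case: u v => [[]x|] [[]y|] uU vU //= neq.
- by apply: fst_fst; apply: contraNneq neq => ->.
- exact: fst_snd.
- by rewrite symdiffC; apply: apex_diff.
- by rewrite symdiffC; apply: fst_snd.
- by apply: snd_snd => //; apply: contraNneq neq => ->.
- by rewrite symdiffC; apply: apex_diff.
- exact: apex_diff.
- exact: apex_diff.
Qed.

Lemma double_induced_Gr i : #|U| = n + i -> Gr (n + i) (k + i) (induced U).
Proof.
move=> cardU; apply: induced_Gr => //; first by move: k2 k3 le_kn; lia.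
  by move=> u /double_nbh_bound; lia.
by move=> u v uU vU neq; have := double_diff_bound uU vU neq; lia.
Qed.

End Double.

(** * Choice of the vertex set *)

Lemma exists_set_card (T : finType) m :
  m <= #|T| -> exists B : {set T}, #|B| = m.
Proof.
move=> le_m; exists [set x in take m (enum T)].
by rewrite cardsE (card_uniqP _) ?take_uniq ?enum_uniq // size_takel -?cardE.
Qed.

Theorem theorem26 (n0 t lam mu k0 : nat)
    (srg : exists G : graph, strongly_regular G n0 t lam mu)
    (k0E : (k0%:Z =
       Num.max (n0%:Z - t%:Z) (Num.max t%:Z
      (Num.max (n0%:Z - 2 * t%:Z + 2 * lam%:Z + 3)
      (Num.max (n0%:Z - 2 * t%:Z + 2 * mu%:Z - 1)
      (Num.max (2 * t%:Z - 2 * lam%:Z - 1)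
               (2 * t%:Z - 2 * mu%:Z + 2))))))%R)
    (le_k0_n0 : k0 <= n0) (i : nat) (le_i : i <= n0.+1) :
  exists G : graph, Gr (n0 + i) (k0 + i) G.
Proof.
have [G srgG] := srg; have cardG : #|G| = n0 by case: srgG.
have [k1 k2 k3] : [/\ n0 <= k0 + t, t <= k0 & n0 + 2 * lam + 3 <= k0 + 2 * t].
  by split; lia.
have [k4 k5 k6] : [/\ n0 + 2 * mu <= k0 + 2 * t + 1,
    2 * t <= k0 + 2 * lam + 1 & 2 * t + 2 <= k0 + 2 * mu] by split; lia.
suff [U [fstU apexU cardU]] : exists U : {set double G},
    [/\ forall x, Some (inl x) \in U, None \in U -> U = setT & #|U| = n0 + i].
  by exists (induced U); apply: (double_induced_Gr srgG).
move: le_i; rewrite leq_eqVlt ltnS => /orP[/eqP-> | le_i].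
  exists setT; split=> // [x|]; first by rewrite inE.
  rewrite cardsT card_option card_sum cardG.
  by rewrite addnS.
have [B cardB] : exists B : {set G}, #|B| = i.
  by apply: exists_set_card; rewrite cardG.
(* The test [u != None] keeps the whole first copy and rejects the apex, so the condition on the
   apex is vacuous. *)
exists [set u | if u is Some (inr x) then x \in B else u != None]; split=> [x||].
- by rewrite inE.
- by rewrite inE.
have -> : [set u : double G | if u is Some (inr x) then x \in B else u != None]
        = Some @: (inl @: [set: G] :|: inr @: B).
  apply/setP => -[[]x|]; rewrite !inE; apply/esym.
  - by apply/imsetP; exists (inl x); rewrite // !inE imset_f.
  - rewrite (mem_imset _ _ Some_inj) inE (mem_imset _ _ inr_inj).
    by rewrite orb_idl // => /imsetP[].
  - by apply/negP => /imsetP[].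
rewrite (card_imset _ Some_inj) cardsU !card_imset ?cardsT ?cardG ?cardB;
  try by move=> ? ? [].
suff -> : inl @: [set: G] :&: inr @: B = set0 :> {set G + G}.
  by rewrite cards0 subn0.
by apply/setP => u; rewrite !inE; apply/negP => /andP[/imsetP[x _ ->] /imsetP[]].
Qed.
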